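(* Let $d\geq 2$ and let $V_d$ be a $d$-dimensional $k$-vector space. The map $det^{S^3}:V_d^{\otimes\binom{3d}{3}}\to k$ is a nontrivial linear map with the property that $det^{S^3}(\otimes_{1\leq i<j<l\leq 3d}(v_{i,j,l}))=0$ if there exist $1\leq x<y<z<t\leq 3d$ such that $v_{x,y,z}=v_{x,y,t}=v_{x,z,t}=v_{y,z,t}$.
   Context: $k$ is a field of characteristic zero, $\otimes=\otimes_k$, and $V_d$ is a $k$-vector space of dimension $d$ with basis $\{e_1,\dots,e_d\}$. The tensor factors of $V_d^{\otimes\binom{3d}{3}}$ are indexed by triples $(i,j,l)$ with $1\le i<j<l\le 3d$. Definition of $det^{S^3}$. Given $v_{i,j,l}\in V_d$ for $1\leq i<j<l\leq 3d$, for each $1\leq m<n\leq 3d$ let $\mathcal{E}_{m,n}$ be the vector equation (in $V_d$, with scalar unknowns $\lambda_{i,j,l}$, $1\le i<j<l\le 3d$) $$\sum_{r=1}^{m-1}(-1)^{r-1}\lambda_{r,m,n}v_{r,m,n}+\sum_{s=m+1}^{n-1}(-1)^s\lambda_{m,s,n}v_{m,s,n}+\sum_{t=n+1}^{3d}(-1)^{t+1}\lambda_{m,n,t}v_{m,n,t}=0.$$ Writing vectors in the basis $e_1,\dots,e_d$, each $\mathcal{E}_{m,n}$ is a block of $d$ scalar linear equations. Let $A_{3d}((v_{i,j,l})_{1\leq i<j<l\leq 3d})$ be the coefficient matrix of the system consisting of the equations $\mathcal{E}_{m,n}$ with $1\leq m<n<3d$; columns are indexed by the triples $(i,j,l)$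 and row blocks by the pairs $(m,n)$, both in lexicographic order. It is a square matrix of size $d\binom{3d-1}{2}\times d\binom{3d-1}{2}$ (note $\binom{3d}{3}=d\binom{3d-1}{2}$). The map $det^{S^3}:V_d^{\otimes\binom{3d}{3}}\to k$ is the linear map determined by $$det^{S^3}(\otimes_{1\leq i<j<l\leq 3d}(v_{i,j,l}))=\det(A_{3d}((v_{i,j,l})_{1\leq i<j<l\leq 3d})),$$ the right-hand side being multilinear in the $v_{i,j,l}$. *)

(* Defs.v *)
From HB Require Import structures.
From mathcomp Require Import all_boot all_order all_algebra.

Set Implicit Arguments.
Unset Strict Implicit.
Unset Printing Implicit Defensive.

Import GRing.Theory.
Local Open Scope ring_scope.

Definition upd (I : finType) (T : Type) (v : {ffun I -> T}) (i : I) (x : T) :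
  {ffun I -> T} := [ffun j => if j == i then x else v j].

Definition multilinear (k : fieldType) (I : finType) (V W : lmodType k)
    (f : {ffun I -> V} -> W) : Prop :=
  forall (v : {ffun I -> V}) (i : I), linear (fun x => f (upd v i x)).

(* The tensor power of V with factors indexed by I, given by its universal    *)
(* property; coordTensorPower below shows that one exists.                    *)
Record tensorPower (k : fieldType) (V : lmodType k) (I : finType) :=
  TensorPower {
    tensor_sort :> lmodType k;
    pure : {ffun I -> V} -> tensor_sort;
    pure_multilinear : multilinear pure;
    tlift : forall (W : lmodType k) (f : {ffun I -> V} -> W),
      multilinear f -> {linear tensor_sort -> W};
    tlift_pure : forall (W : lmodType k) (f : {ffun I -> V} -> W)
      (mf : multilinear f) (v : {ffun I -> V}), tlift mf (pure v) = f v;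
    tlift_unique : forall (W : lmodType k) (f : {ffun I -> V} -> W)
      (mf : multilinear f) (g : {linear tensor_sort -> W}),
      (forall v, g (pure v) = f v) -> g =1 tlift mf }.
Arguments pure {k V I} t v.

Section CoordinateModel.
Variables (k : fieldType) (V : vectType k) (I : finType).
Variables (n : nat) (e : n.-tuple V) (he : basis_of fullv e).

Let G := {ffun I -> 'I_n}.
Let T : lmodType k := {ffun G -> k^o}.

Let be (g : G) : {ffun I -> V} := [ffun i => e`_(g i)].

Lemma multilinear_ext (W : lmodType k) (f h : {ffun I -> V} -> W) :
  multilinear f -> multilinear h -> (forall g, f (be g) = h (be g)) -> f =1 h.
Proof.
move=> mf mh fh v.
move: {2}(#|_|).+1 (ltnSn #|[set i | v i \notin e]|) => m.
elim: m v => // m IHm v; rewrite ltnS => lev.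
have [/eqP c0|/set0Pn[i]] := boolP ([set i | v i \notin e] == set0).
  have ve i : v i \in e by apply/negPn; have := in_set0 i; rewrite -c0 inE => ->.
  have ix i : (index (v i) e < n)%N.
    by rewrite -[X in (_ < X)%N](size_tuple e) index_mem.
  suff -> : v = be [ffun i => Ordinal (ix i)] by [].
  by apply/ffunP=> i; rewrite !ffunE nth_index.
rewrite inE => vi.
have vE : v = upd v i (\sum_j coord e j (v i) *: e`_j).
  apply/ffunP=> j; rewrite ffunE; case: eqP => // ->.
  by apply: (coord_basis he); apply: memvf.
have step (j : 'I_n) : f (upd v i e`_j) = h (upd v i e`_j).
  apply: IHm; apply: leq_trans lev; apply/proper_card/properP; split.
    apply/subsetP=> l; rewrite !inE ffunE; case: eqP => // ->.
    by rewrite mem_nth // size_tuple.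
  by exists i; rewrite !inE // ffunE eqxx mem_nth // size_tuple.
have sumE (q : {ffun I -> V} -> W) : multilinear q ->
    q v = \sum_j coord e j (v i) *: q (upd v i e`_j).
  move=> mq; pose L := GRing.isLinear.Build _ _ _ _ _ (mq v i).
  pose lq : {linear V -> W} := HB.pack (fun x => q (upd v i x)) L.
  rewrite {1}vE -[LHS]/(lq _) linear_sum; apply: eq_bigr => j _.
  by rewrite linearZ.
by rewrite (sumE f) // (sumE h) //; apply: eq_bigr => j _; rewrite step.
Qed.

Definition coord_pure (v : {ffun I -> V}) : T :=
  [ffun g : G => \prod_i coord e (g i) (v i)].

Lemma coord_pure_multilinear : multilinear coord_pure.
Proof.
move=> v i a x y; apply/ffunP=> g.
have PE z : coord_pure (upd v i z) g =
    coord e (g i) z * \prod_(j | j != i) coord e (g j) (v j).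
  rewrite [LHS]ffunE (bigD1 i) //= [upd v i z i]ffunE eqxx; congr (_ * _).
  by apply: eq_bigr => j /negPf ji; rewrite ffunE ji.
rewrite PE linearP mulrDl [X in _ = X]ffunE [X in _ = X + _]ffunE !PE.
by rewrite -[LHS]/(_ * _ * _ + _) -mulrA.
Qed.

Lemma coord_pure_basis g : coord_pure (be g) = [ffun h => (h == g)%:R].
Proof.
apply/ffunP=> h; rewrite !ffunE.
have fe := basis_free he.
have [->|hg] := eqVneq h g.
  by rewrite big1 // => i _; rewrite ffunE coord_free // eqxx.
have [i hi] : exists i, h i != g i.
  apply/existsP; rewrite -negb_forall; apply: contra hg => /forallP H.
  by apply/eqP/ffunP=> i; apply/eqP.
by rewrite (bigD1 i) //= ffunE coord_free // eq_sym (negPf hi) mul0r.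
Qed.

Section Lift.
Variables (W : lmodType k) (f : {ffun I -> V} -> W).
Definition coord_tlift_fun (t : T) : W := \sum_(g : G) t g *: f (be g).
Lemma coord_tlift_linear : linear coord_tlift_fun.
Proof.
move=> a s t; rewrite /coord_tlift_fun scaler_sumr -big_split.
by apply: eq_bigr => g _; rewrite !ffunE scalerDl scalerA.
Qed.
HB.instance Definition _ :=
  GRing.isLinear.Build k T W _ coord_tlift_fun coord_tlift_linear.
End Lift.

Definition coord_tlift (W : lmodType k) (f : {ffun I -> V} -> W)
  (_ : multilinear f) : {linear T -> W} := coord_tlift_fun f.

Lemma coord_tlift_pure (W : lmodType k) (f : {ffun I -> V} -> W)
  (mf : multilinear f) v : coord_tlift mf (coord_pure v) = f v.
Proof.
move: v; apply: multilinear_ext => // [v i a x y|g] /=.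
  by rewrite coord_pure_multilinear linearP.
rewrite coord_pure_basis /= /coord_tlift_fun (bigD1 g) //= ffunE eqxx scale1r.
by rewrite big1 ?addr0 // => h /negPf hg; rewrite ffunE hg scale0r.
Qed.

Lemma coord_tlift_unique (W : lmodType k) (f : {ffun I -> V} -> W)
    (mf : multilinear f) (g : {linear T -> W}) :
  (forall v, g (coord_pure v) = f v) -> g =1 coord_tlift mf.
Proof.
move=> gf t.
have -> : t = \sum_(h : G) (t h : k) *: coord_pure (be h).
  apply/ffunP=> h; rewrite sum_ffunE (bigD1 h) //= coord_pure_basis !ffunE.
  rewrite eqxx /GRing.scale /= mulr1 big1 ?addr0 // => h' hh.
  by rewrite coord_pure_basis !ffunE eq_sym (negPf hh) /GRing.scale /= mulr0.
rewrite !linear_sum; apply: eq_bigr => h _.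
by rewrite !linearZ gf /= -[coord_tlift_fun f _]/(coord_tlift mf _) coord_tlift_pure.
Qed.

Definition coordTensorPower : tensorPower V I :=
  TensorPower coord_pure_multilinear coord_tlift_pure coord_tlift_unique.

End CoordinateModel.

(* Vertices 1, ..., 3d are encoded as 0, ..., 3d - 1. *)
Definition triple (d : nat) :=
  {p : 'I_(3 * d) * 'I_(3 * d) * 'I_(3 * d) | (p.1.1 < p.1.2 < p.2)%N}.

Definition tri (d : nat) (i j l : 'I_(3 * d)) (ij : (i < j)%N) (jl : (j < l)%N) :
  triple d := exist _ (i, j, l) (introT andP (conj ij jl)).

(* The pairs (m, n) with 1 <= m < n < 3d in the 1-based numbering. *)
Definition row_pair (d : nat) :=
  {p : 'I_(3 * d) * 'I_(3 * d) | (p.1 < p.2)%N && (p.2.+1 < 3 * d)%N}.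

Section System.
Variables (k : fieldType) (d : nat).

(* lambda_{i,j,l} v_{i,j,l}; only used at i < j < l. *)
Definition term (V : lmodType k) (v : {ffun triple d -> V})
    (lam : {ffun triple d -> k}) (i j l : 'I_(3 * d)) : V :=
  if insub (i, j, l) is Some p then lam p *: v p else 0.

(* The left-hand side of E_{m,n}. The 1-based signs (-1)^(r-1), (-1)^s and    *)
(* (-1)^(t+1) are written in terms of the 0-based indices.                    *)
Definition eqn_lhs (V : lmodType k) (v : {ffun triple d -> V})
    (lam : {ffun triple d -> k}) (m n : 'I_(3 * d)) : V :=
  \sum_(r < 3 * d | (r < m)%N) (-1) ^+ r *: term v lam r m n
  + \sum_(s < 3 * d | (m < s < n)%N) (-1) ^+ s.+1 *: term v lam m s n
  + \sum_(t < 3 * d | (n < t)%N) (-1) ^+ t.+2 *: term v lam m n t.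

Definition unit_lam (p : triple d) : {ffun triple d -> k} :=
  [ffun q => (q == p)%:R].

End System.

Definition msize (d : nat) : nat := d * 'C((3 * d).-1, 2).

Lemma card_triple_bin d : #|{: triple d}| = 'C(3 * d, 3).
Proof.
rewrite -card_ltn_sorted_tuples.
pose f (p : triple d) : 3.-tuple 'I_(3 * d) :=
  [tuple (val p).1.1; (val p).1.2; (val p).2].
have fi : injective f.
  move=> [[[a b] c] h] [[[a' b'] c'] h'] E; apply: val_inj => /=.
  by case: E => -> -> ->.
rewrite -(card_imset _ fi); apply: eq_card => t; rewrite inE.
apply/imsetP/idP => [[[[[a b] c] /= h] _ ->] /= | ].
  by rewrite andbT.
case/tupleP: t => a t; case/tupleP: t => b t; case/tupleP: t => c t.
rewrite (tuple0 t) /= andbT => h.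
by exists (exist _ (a, b, c) h) => //; apply: val_inj.
Qed.

Lemma card_row_pair d : #|{: row_pair d}| = 'C((3 * d).-1, 2).
Proof.
rewrite -card_ltn_sorted_tuples.
have lt1 (p : row_pair d) : ((val p).1 < (3 * d).-1)%N.
  case: p => [[a b] /= /andP[ab bd]]; rewrite -ltnS prednK; last first.
    by apply: leq_trans bd.
  by apply: leq_trans bd; rewrite ltnS ltnW.
have lt2 (p : row_pair d) : ((val p).2 < (3 * d).-1)%N.
  case: p => [[a b] /= /andP[ab bd]]; rewrite -ltnS prednK //.
  by apply: leq_trans bd.
pose f (p : row_pair d) : 2.-tuple 'I_((3 * d).-1) :=
  [tuple Ordinal (lt1 p); Ordinal (lt2 p)].
have fi : injective f.
  move=> [[a b] h] [[a' b'] h'] E; apply: val_inj => /=.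
  by case: E => /val_inj-> /val_inj->.
rewrite -(card_imset _ fi); apply: eq_card => t; rewrite inE.
apply/imsetP/idP => [[[[a b] /= h] _ ->] /= | ].
  by rewrite andbT; case/andP: h.
case/tupleP: t => a t; case/tupleP: t => b t.
rewrite (tuple0 t) /= andbT => h.
have le : ((3 * d).-1 <= 3 * d)%N by exact: leq_pred.
have bP : ((widen_ord le a < widen_ord le b) && ((widen_ord le b).+1 < 3 * d))%N.
  by rewrite /= h /=; have := ltn_ord b; case: (3 * d)%N b {a le h} => // m b.
exists (exist _ (widen_ord le a, widen_ord le b) bP) => //.
by apply: val_inj; congr [:: _; _]; apply: val_inj.
Qed.

Lemma card_cols d : #|{: triple d}| = msize d.
Proof.
rewrite card_triple_bin /msize; apply/eqP; rewrite -(eqn_pmul2l (isT : 0 < 3)%N).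
by rewrite -mul_bin_diag mulnA.
Qed.

Lemma card_rows d : #|{: row_pair d * 'I_d}| = msize d.
Proof. by rewrite card_prod card_row_pair card_ord mulnC. Qed.

(* The enumerations of ordinals, products and subtypes are increasing for the *)
(* lexicographic order, so columns are the triples in lexicographic order and *)
(* rows are the blocks of d coordinates of the pairs in lexicographic order.  *)
Definition col_triple (d : nat) (c : 'I_(msize d)) : triple d :=
  enum_val (cast_ord (esym (card_cols d)) c).

Definition row_index (d : nat) (r : 'I_(msize d)) : row_pair d * 'I_d :=
  enum_val (cast_ord (esym (card_rows d)) r).

Lemma det_col_linear (k : fieldType) n (A B C : 'M[k]_n) c0 a :
    (forall r, A r c0 = a * B r c0 + C r c0) ->
    (forall r c, c != c0 -> A r c = B r c) ->
    (forall r c, c != c0 -> A r c = C r c) ->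
  \det A = a * \det B + \det C.
Proof.
move=> ABC AB AC; rewrite -(det_tr A) -(det_tr B) -(det_tr C).
rewrite -[X in _ + X]mul1r; apply: (@determinant_multilinear _ _ _ _ _ c0).
- by apply/rowP=> r; rewrite !mxE mul1r ABC.
- by apply/matrixP=> i r; rewrite !mxE AB // eq_sym neq_lift.
- by apply/matrixP=> i r; rewrite !mxE AC // eq_sym neq_lift.
Qed.

Section DetS3.
Variables (k : fieldType) (d : nat) (V : vectType k) (e : d.-tuple V).

(* Column (i, j, l) holds the left-hand sides at lambda = delta_{(i, j, l)}.  *)
Definition coef_mx (v : {ffun triple d -> V}) : 'M[k]_(msize d) :=
  \matrix_(r, c)
    let: (p, a) := row_index r in
    coord e a (eqn_lhs v (unit_lam k (col_triple c)) (val p).1 (val p).2).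

Lemma term_unit (v : {ffun triple d -> V}) (p : triple d) i j l :
  term v (unit_lam k p) i j l =
  term [ffun=> 1 : k^o] (unit_lam k p) i j l *: v p.
Proof.
rewrite /term; case: insub => [q|]; last by rewrite scale0r.
rewrite !ffunE -[_ *: (1 : k^o)]/(_ * 1 : k) mulr1.
by have [->|_] := eqVneq q p; rewrite ?scale1r // !scale0r.
Qed.

Lemma eqn_lhs_unit (v : {ffun triple d -> V}) (p : triple d) m n :
  eqn_lhs v (unit_lam k p) m n =
  eqn_lhs [ffun=> 1 : k^o] (unit_lam k p) m n *: v p.
Proof.
rewrite /eqn_lhs !scalerDl !scaler_suml.
by congr (_ + _ + _); apply: eq_bigr => i _; rewrite term_unit scalerA.
Qed.

Lemma coef_mxE (v : {ffun triple d -> V}) r c :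
  coef_mx v r c =
  (eqn_lhs [ffun=> 1 : k^o] (unit_lam k (col_triple c))
    (val (row_index r).1).1 (val (row_index r).1).2 : k)
  * coord e (row_index r).2 (v (col_triple c)).
Proof.
by rewrite [LHS]mxE; case: (row_index r) => q b; rewrite eqn_lhs_unit linearZ.
Qed.

Lemma det_coef_multilinear :
  multilinear (fun v : {ffun triple d -> V} => \det (coef_mx v) : k^o).
Proof.
move=> v p a x y.
pose c0 : 'I_(msize d) := cast_ord (card_cols d) (enum_rank p).
have colE c : (col_triple c == p) = (c == c0).
  rewrite /c0; apply/eqP/eqP => [<-|->]; first by rewrite enum_valK cast_ordKV.
  by rewrite /col_triple cast_ordK enum_rankK.
pose F z := coef_mx (upd v p z).
have FE z r c : F z r c =
    (eqn_lhs [ffun=> 1 : k^o] (unit_lam k (col_triple c))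
      (val (row_index r).1).1 (val (row_index r).1).2 : k)
    * coord e (row_index r).2 (if c == c0 then z else v (col_triple c)).
  by rewrite [LHS]coef_mxE [upd v p z _]ffunE colE.
change (\det (F (a *: x + y)) = a * \det (F x) + \det (F y)).
move: F FE => F FE.
apply: (@det_col_linear k _ _ _ _ c0 a) => [r|r c cc0|r c cc0].
- by rewrite !FE eqxx linearP mulrDr mulrCA.
- by rewrite !FE (negPf cc0).
- by rewrite !FE (negPf cc0).
Qed.

Definition detS3 (T : tensorPower V (triple d)) : {linear T -> k^o} :=
  tlift T det_coef_multilinear.

Lemma detS3_pure (T : tensorPower V (triple d)) (v : {ffun triple d -> V}) :
  detS3 T (pure T v) = \det (coef_mx v).
Proof. exact: tlift_pure. Qed.

End DetS3.

(* Main.v *)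
Require Import Defs.
From HB Require Import structures.
From mathcomp Require Import all_boot all_order all_algebra.
From mathcomp Require Import zify ring.

(* Choosing every v_p among the basis vectors splits the triples into d       *)
(* 2-complexes, and the matrix is block diagonal up to signs and order: its   *)
(* blocks are the boundary matrices of these complexes, with the edges at the *)
(* last vertex deleted. So the determinant is nonzero as soon as every        *)
(* 1-cochain whose coboundary vanishes on one of the complexes has zero       *)
(* coboundary on all triples. With the vertices cut into d blocks {3j, 3j+1,  *)
(* 3j+2}, such a partition is obtained by putting x < y < z in the class      *)
(* given by the block of x, y or z, according to x + y + z mod 3. Triples     *)
(* where the coboundary vanishes are closed under one rule: three faces of a  *)
(* tetrahedron force the fourth. Starting from class c, this closure fills    *)
(* first the blocks up to c, then one more block at a time: above c, the      *)
(* pairs forming a triple of class c with a new vertex contain a spanning     *)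
(* tree of the earlier vertices. For the vanishing property, the boundary of  *)
(* the tetrahedron x, y, z, t, with (i, j, l) rescaled by (-1)^(i+j+l), is in *)
(* the kernel of the matrix.                                                  *)

Set Implicit Arguments.
Unset Strict Implicit.
Unset Printing Implicit Defensive.

Import GRing.Theory.

(** The class rule works because a block has one vertex of each residue mod 3: two vertices outside
    block [c] lie in exactly one triangle of class [c] with third vertex in block [c]. This drives
    [class_fills]; [cocycle_class_eq0] turns it into the vanishing of cochains, whence
    [det_coef_class_neq0]. The vanishing property rests on [det_coef_tetrahedron]. *)

Definition tri_class (x y z : nat) : nat :=
  (nth 0 [:: x; y; z] ((x + y + z) %% 3)) %/ 3.

(** * Closure of one class under the tetrahedron rule *)

Section Filling.
Variables (P : nat -> nat -> nat -> Prop) (d c : nat).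
Hypothesis Pdeg : forall x y, P x x y.
Hypothesis Pswap : forall x y z, P x y z -> P y x z.
Hypothesis Prot : forall x y z, P x y z -> P y z x.
Hypothesis Ptet : forall w x y z, P w x y -> P w y z -> P w x z -> P x y z.
Hypothesis cd : c < d.
Hypothesis Pclass : forall x y z,
  x < y -> y < z -> z < 3 * d -> tri_class x y z = c -> P x y z.

Lemma fill_min x y z : x < y -> y < z -> z < 3 * d ->
  (x + y + z) %% 3 = 0 -> x %/ 3 = c -> P x y z.
Proof. by move=> xy yz zd s xc; apply: Pclass; rewrite // /tri_class s. Qed.

Lemma fill_mid x y z : x < y -> y < z -> z < 3 * d ->
  (x + y + z) %% 3 = 1 -> y %/ 3 = c -> P x y z.
Proof. by move=> xy yz zd s yc; apply: Pclass; rewrite // /tri_class s. Qed.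

Lemma fill_max x y z : x < y -> y < z -> z < 3 * d ->
  (x + y + z) %% 3 = 2 -> z %/ 3 = c -> P x y z.
Proof. by move=> xy yz zd s zc; apply: Pclass; rewrite // /tri_class s. Qed.

Let o := 3 * c.

(** Triangles at the apex [o] suffice: [Ptet] then yields all the others. *)
Let complete n := forall x y, x < n -> y < n -> P o x y.

Lemma completeP n x y z : complete n -> x < n -> y < n -> z < n -> P x y z.
Proof. by move=> Pn xn yn zn; apply: (@Ptet o); apply: Pn. Qed.

Lemma complete_ltn n :
  (forall x y, x < y -> y < n -> P o x y) -> complete n.
Proof.
move=> Pn x y xn yn; have [xy|yx|<-] := ltngtP x y.
- exact: Pn.
- by apply: Prot; apply: Pswap; apply: Pn.
- by apply: Prot; apply: Prot.
Qed.

Lemma fill_block : P o o.+1 o.+2.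
Proof. by apply: fill_min; rewrite /o; lia. Qed.

(** Of the three triangles joining [x] to an edge of block [c], only the one with sum 0 mod 3 goes
    to the block of [x]; the other two have class [c], and [fill_block] supplies the third face. *)
Lemma fill_below_block x : x < o ->
  [/\ P x o o.+1, P x o o.+2 & P x o.+1 o.+2].
Proof.
rewrite /o => xo; have B := fill_block; rewrite /o in B.
have M r s : 3 * c <= r -> r < s -> s < 3 * c + 3 -> (x + r + s) %% 3 = 1 ->
  P x r s by move=> *; apply: fill_mid; lia.
have X r s : 3 * c <= r -> r < s -> s < 3 * c + 3 -> (x + r + s) %% 3 = 2 ->
  P x r s by move=> *; apply: fill_max; lia.
have : x %% 3 < 3 by rewrite ltn_mod.
case E: (x %% 3) => [|[|[|//]]] _.
- have H1 : P x (3 * c) (3 * c).+1 by apply: M; lia.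
  have H2 : P x (3 * c) (3 * c).+2 by apply: X; lia.
  split=> //; apply: (@Ptet (3 * c)) => //; eauto using Pswap, Prot.
- have H1 : P x (3 * c) (3 * c).+1 by apply: X; lia.
  have H2 : P x (3 * c).+1 (3 * c).+2 by apply: M; lia.
  split=> //; apply: (@Ptet (3 * c).+1); eauto using Pswap, Prot.
- have H1 : P x (3 * c) (3 * c).+2 by apply: M; lia.
  have H2 : P x (3 * c).+1 (3 * c).+2 by apply: X; lia.
  split=> //; apply: (@Ptet (3 * c).+2); eauto using Pswap, Prot.
Qed.

Lemma complete_block : complete (o + 3).
Proof.
apply: complete_ltn => x y xy yo.
have [xo|ox] := ltnP x o; last first.
  have [-> //|nx] := eqVneq x o.
  have -> : x = o.+1 by lia.
  have -> : y = o.+2 by lia.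
  exact: fill_block.
have [H1 H2 H3] := fill_below_block xo.
have [yo'|oy] := ltnP y o; last first.
  have [->|[->|->]] : y = o \/ y = o.+1 \/ y = o.+2 by lia.
  - exact: Prot.
  - exact: Pswap.
  - exact: Pswap.
have [K1 K2 K3] := fill_below_block yo'.
have [r [ro xyr Pxyr]] : exists r,
    [/\ r = o \/ r = o.+1 \/ r = o.+2, y < r & P x y r].
  (* The offset makes the sum 2 mod 3, where the largest vertex decides the class. *)
  exists (o + (2 + 2 * x + 2 * y) %% 3); split; rewrite /o in xo yo' *; try lia.
  by apply: fill_max; lia.
case: ro Pxyr => [->|[->|->]] Pxyr; first by eauto using Prot.
- by apply: (@Ptet o.+1); eauto using Pswap, Prot.
- by apply: (@Ptet o.+2); eauto using Pswap, Prot.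
Qed.

Lemma complete_step D :
  c < D -> D < d -> complete (3 * D) -> complete (3 * D + 3).
Proof.
move=> cD Dd IH.
have old x y z : x < 3 * D -> y < 3 * D -> z < 3 * D -> P x y z.
  exact: completeP.
have block r : 3 * D <= r -> r < 3 * D + 3 ->
    [/\ P r o o.+1, P r o o.+2 & P r o.+1 o.+2].
  move=> Dr rD; rewrite /o.
  have L x y : 3 * c <= x -> x < y -> y < 3 * c + 3 -> (x + y + r) %% 3 = 0 ->
      P r x y.
    by move=> *; do 2!apply: Prot; apply: fill_min; lia.
  have M x y : 3 * c <= x -> x < y -> y < 3 * c + 3 -> (x + y + r) %% 3 = 1 ->
      P r x y.
    by move=> *; do 2!apply: Prot; apply: fill_mid; lia.
  have B : P (3 * c) (3 * c).+1 (3 * c).+2 by apply: fill_block.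
  have : r %% 3 < 3 by rewrite ltn_mod.
  case E: (r %% 3) => [|[|[|//]]] _.
  - have H1 : P r (3 * c) (3 * c).+1 by apply: M; lia.
    have H2 : P r (3 * c).+1 (3 * c).+2 by apply: L; lia.
    split=> //; apply: (@Ptet (3 * c).+1); eauto using Pswap, Prot.
  - have H1 : P r (3 * c) (3 * c).+2 by apply: L; lia.
    have H2 : P r (3 * c).+1 (3 * c).+2 by apply: M; lia.
    split=> //; apply: (@Ptet (3 * c).+2); eauto using Pswap, Prot.
  - have H1 : P r (3 * c) (3 * c).+1 by apply: L; lia.
    have H2 : P r (3 * c) (3 * c).+2 by apply: M; lia.
    split=> //; apply: (@Ptet (3 * c)); eauto using Pswap, Prot.
have blocko r x : 3 * D <= r -> r < 3 * D + 3 -> o <= x -> x < o + 3 -> P o x r.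
  move=> Dr rD ox xo; have [H1 H2 H3] := block r Dr rD.
  have [->|[->|->]] : x = o \/ x = o.+1 \/ x = o.+2 by lia.
  - exact: Pdeg.
  - exact: Prot.
  - exact: Prot.
have cone r x : 3 * D <= r -> r < 3 * D + 3 -> x < 3 * D -> P o x r.
  move=> Dr rD xD.
  (* The triangle is degenerate if [x] is itself in block [c]; otherwise [x'] is chosen by residue
     to give class [c]. *)
  have [x' [ox' xo' Pr]] : exists x', [/\ o <= x', x' < o + 3 & P x x' r].
    have [xo|ox] := ltnP x o.
      exists (o + (1 + 2 * x + 2 * r) %% 3); split; rewrite /o in xo *; try lia.
      by apply: fill_mid; lia.
    have [xo3|ox3] := ltnP x (o + 3).
      by exists x.
    exists (o + (2 * x + 2 * r) %% 3); split; rewrite /o in ox ox3 *; try lia.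
    by apply: Pswap; apply: fill_min; lia.
  have H1 := blocko r x' Dr rD ox' xo'.
  have H2 : P o x x' by apply: old; rewrite /o in ox' xo' *; lia.
  by apply: (@Ptet x'); eauto using Pswap, Prot.
apply: complete_ltn => x y xy yD.
have [yD'|Dy] := ltnP y (3 * D); first by apply: old; rewrite /o; lia.
have [xD|Dx] := ltnP x (3 * D); first exact: cone.
have [x' [ox' xo' Px]] : exists x', [/\ o <= x', x' < o + 3 & P x' x y].
  exists (o + (2 * x + 2 * y) %% 3); split; rewrite /o; try lia.
  by apply: fill_min; lia.
have H1 := blocko x x' Dx (ltn_trans xy yD) ox' xo'.
have H2 := blocko y x' Dy yD ox' xo'.
by apply: (@Ptet x'); eauto using Pswap, Prot.
Qed.

Lemma class_fills x y z : x < 3 * d -> y < 3 * d -> z < 3 * d -> P x y z.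
Proof.
suff C : complete (3 * d) by move=> *; apply: completeP C _ _ _.
have H n : c + n < d -> complete (3 * (c + n) + 3).
  elim: n => [|n IHn] nd; first by rewrite addn0; apply: complete_block.
  by apply: complete_step; rewrite ?addnS ?mulnSr; [lia..|apply: IHn; lia].
have -> : 3 * d = 3 * (c + (d - c.+1)) + 3 by lia.
by apply: H; lia.
Qed.
End Filling.

Local Open Scope ring_scope.

(** * Matrix entries as signed incidences *)

Lemma term_unit_lam (k : fieldType) d (p : triple d) (i j l : 'I_(3 * d)) :
  term [ffun=> 1 : k^o] (unit_lam k p) i j l = ((i, j, l) == val p)%:R.
Proof.
rewrite /term; case: insubP => [q _ <-|np].
  by rewrite !ffunE -[LHS]/(_ * 1) mulr1 (inj_eq val_inj).
by case: eqP => // E; rewrite E (valP p) in np.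
Qed.

(** The edge opposite a vertex carries the usual boundary sign times (-1) to the power of that
    vertex. *)
Lemma eqn_lhs_unit_lam (k : fieldType) d (p : triple d) (m n : 'I_(3 * d)) :
  let: (i, j, l) := val p in
  eqn_lhs [ffun=> 1 : k^o] (unit_lam k p) m n =
  (-1) ^+ i * ((m, n) == (j, l))%:R - (-1) ^+ j * ((m, n) == (i, l))%:R
  + (-1) ^+ l * ((m, n) == (i, j))%:R :> k.
Proof.
case Ep: (val p) => [[i j] l].
have /andP[/= ij jl] : (i < j < l)%N by have := valP p; rewrite Ep.
rewrite /eqn_lhs.
have pick (Q : pred 'I_(3 * d)) (s : 'I_(3 * d) -> k)
    (f : 'I_(3 * d) -> k^o) x (b : bool) :
    (b -> Q x) -> (forall r, f r = ((r == x) && b)%:R) ->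
  \sum_(r < 3 * d | Q r) s r *: f r = s x * b%:R :> k.
  move=> bQ fE; rewrite big_mkcond (bigD1 x) //= big1 ?addr0 => [|r /negPf rx].
    rewrite fE eqxx; case: b bQ {fE} => [->//|_].
    by rewrite scaler0 mulr0 if_same.
  by rewrite fE rx scaler0 if_same.
rewrite (pick _ _ _ i ((m, n) == (j, l))); first last.
- by move=> r; rewrite term_unit_lam Ep !xpair_eqE -andbA.
- by rewrite xpair_eqE => /andP[/eqP-> _].
rewrite (pick _ _ _ j ((m, n) == (i, l))); first last.
- move=> r; rewrite term_unit_lam Ep !xpair_eqE [m == i]eq_sym.
  by do 3!case: eqP.
- by rewrite xpair_eqE => /andP[/eqP-> /eqP->]; rewrite ij.
rewrite (pick _ _ _ l ((m, n) == (i, j))); first last.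
- by move=> r; rewrite term_unit_lam Ep !xpair_eqE andbC.
- by rewrite xpair_eqE => /andP[_ /eqP->].
by rewrite !exprS; ring.
Qed.

(** * Cochains closed on one class *)

Section CocycleVanishing.
Variables (k : fieldType) (d : nat) (c : nat) (w : row_pair d -> k).
Hypothesis cd : (c < d)%N.
Hypothesis wP : forall p : triple d,
  tri_class (val p).1.1 (val p).1.2 (val p).2 = c ->
  \sum_(q : row_pair d) w q *
    (eqn_lhs [ffun=> 1 : k^o] (unit_lam k p) (val q).1 (val q).2 : k) = 0.

Let g (m n : nat) : k := \sum_(q : row_pair d)
  w q * (((val q).1 == m :> nat) && ((val q).2 == n :> nat))%:R.

Let g_out m n : ~~ ((m < n) && (n.+1 < 3 * d))%N -> g m n = 0.
Proof.
move=> mn; apply: big1 => q _; case: andP => [[/eqP qm /eqP qn]|_]; last first.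
  by rewrite mulr0.
by have := valP q; rewrite qm qn (negPf mn).
Qed.

Let g_in (q : row_pair d) : g (val q).1 (val q).2 = w q.
Proof.
rewrite /g (bigD1 q) //= !eqxx mulr1 big1 ?addr0 // => r rq.
case: andP => [[/eqP E1 /eqP E2]|_]; last by rewrite mulr0.
case/eqP: rq; apply: val_inj.
rewrite [LHS]surjective_pairing [RHS]surjective_pairing.
by congr (_, _); apply: val_inj.
Qed.

(* The sign turns the signs of E_{m,n} into the usual coboundary signs. *)
Let h m n : k := (-1) ^+ (m + n) * (g m n - g n m).

Let h_last m n : (3 * d <= n.+1)%N -> h m n = 0.
Proof. by move=> dn; rewrite /h !g_out ?subrr ?mulr0 //; lia. Qed.

Let hN m n : h n m = - h m n.
Proof. by rewrite /h addnC -mulrN opprB. Qed.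

(** By [class_fills], [h] is closed on all triangles. In a triangle whose third vertex is the last
    one, two edges carry 0, hence so does the remaining edge. *)
Lemma cocycle_class_eq0 q : w q = 0.
Proof.
pose P x y z := h x y + h y z + h z x = 0.
have hE m n : (m < n)%N -> h m n = (-1) ^+ (m + n) * g m n.
  by move=> mn; rewrite /h (g_out (m := n)) ?subr0 //; lia.
have PT x y z :
    (x < 3 * d)%N -> (y < 3 * d)%N -> (z < 3 * d)%N -> P x y z.
  move: x y z.
  apply: (@class_fills P d c) => //; rewrite /P.
  - by move=> x y; rewrite (hN x y) /h !subrr mulr0 add0r addrN.
  - move=> x y z E; rewrite (hN x y) (hN z x) (hN y z) -!opprD.
    by rewrite -[RHS]oppr0 -E; congr (- _); ring.
  - by move=> x y z <-; ring.
  - move=> x' x y z H1 H2 H3.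
    transitivity ((h x' x + h x y + h y x') + (h x' y + h y z + h z x')
      - (h x' x + h x z + h z x')); last by rewrite H1 H2 H3 subr0 addr0.
    by rewrite (hN x z) (hN x' y); ring.
  move=> x y z xy yz zd cl.
  have xd : (x < 3 * d)%N by lia.
  have yd : (y < 3 * d)%N by lia.
  pose p : triple d :=
    tri (i := Ordinal xd) (j := Ordinal yd) (l := Ordinal zd) xy yz.
  have /= := wP (p := p) cl.
  under eq_bigr => r _ do rewrite (eqn_lhs_unit_lam _ p) /=.
  move=> E.
  have {}E :
      (-1) ^+ x * g y z - (-1) ^+ y * g x z + (-1) ^+ z * g x y = 0.
    rewrite -E /g !mulr_sumr -sumrB -big_split /=; apply: eq_bigr => r _.
    by rewrite !xpair_eqE -!val_eqE /=; ring.
  rewrite (hN x z) !hE //; last by lia.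
  (* The factor leaves each edge with the sign of its own two endpoints, as in [h]. *)
  transitivity ((-1) ^+ (x + y + z) *
     ((-1) ^+ x * g y z - (-1) ^+ y * g x z + (-1) ^+ z * g x y)); last first.
    by rewrite E mulr0.
  have s n : (-1) ^+ n * (-1) ^+ n = 1 :> k.
    by rewrite -expr2 sqrr_sign.
  rewrite !exprD; ring: (s x) (s y) (s z).
have := valP q; case E: (val q) => [m n] /andP[/= mn nd].
have l1 : (3 * d <= (3 * d).-1.+1)%N by lia.
have : P m n (3 * d).-1 by apply: PT; lia.
rewrite /P (hN m) !(h_last _ l1) oppr0 !addr0 hE // => /eqP.
rewrite mulf_eq0 signr_eq0 /= => /eqP gmn.
by rewrite -g_in E.
Qed.
End CocycleVanishing.

(** * Nonvanishing and vanishing of the determinant *)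

Lemma col_triple_bij d : bijective (@col_triple d).
Proof.
exists (fun p => cast_ord (card_cols d) (enum_rank p)) => x.
  by rewrite enum_valK cast_ordKV.
by rewrite /col_triple cast_ordK enum_rankK.
Qed.

Lemma row_index_bij d : bijective (@row_index d).
Proof.
exists (fun p => cast_ord (card_rows d) (enum_rank p)) => x.
  by rewrite enum_valK cast_ordKV.
by rewrite /row_index cast_ordK enum_rankK.
Qed.

Section Determinant.
Variables (k : fieldType) (d : nat) (V : vectType k) (e : d.-tuple V).

Lemma det_coef_class_neq0 (he : basis_of fullv e) :
  \det (coef_mx e [ffun p : triple d =>
    e`_(tri_class (val p).1.1 (val p).1.2 (val p).2)]) != 0.
Proof.
set v := finfun _; apply/negP => /det0P[u u0 uA]; case/eqP: u0.
have [ri riK rKi] := row_index_bij d; have [ci ciK cKi] := col_triple_bij d.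
apply/rowP => r; rewrite [RHS]mxE -(riK r); case: (row_index r) => q a.
(* The coordinate-[a] entries of the left kernel vector [u] form a cochain; columns of class [a]
   meet only those rows. *)
apply: (cocycle_class_eq0 (w := fun q => u 0 (ri (q, a))) (ltn_ord a)).
move=> p pa; transitivity ((u *m coef_mx e v) 0 (ci p)); last by rewrite uA mxE.
rewrite mxE (reindex ri) /=; last by exists (@row_index d) => x _.
transitivity (\sum_q \sum_b
    u 0 (ri (q, b)) * coef_mx e v (ri (q, b)) (ci p)); last first.
  by rewrite pair_bigA; apply: eq_bigr => -[].
apply: eq_bigr => m _; rewrite (bigD1 a) //= big1 ?addr0 => [|b ba].
  rewrite coef_mxE rKi cKi ffunE pa coord_free ?(basis_free he) //.
  by rewrite eqxx mulr1.
rewrite coef_mxE rKi cKi ffunE pa coord_free ?(basis_free he) //.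
by rewrite eq_sym (negPf ba) !mulr0.
Qed.

Lemma det_coef_tetrahedron (v : {ffun triple d -> V}) (x y z t : 'I_(3 * d))
    (xy : (x < y)%N) (yz : (y < z)%N) (zt : (z < t)%N)
    (xz : (x < z)%N) (yt : (y < t)%N) :
  v (tri xy yz) = v (tri xy yt) -> v (tri xy yt) = v (tri xz zt) ->
  v (tri xz zt) = v (tri yz zt) -> \det (coef_mx e v) = 0.
Proof.
move=> v1 v2 v3; rewrite -det_tr; apply/eqP/det0P.
have [ci ciK cKi] := col_triple_bij d.
pose s (i : 'I_(3 * d)) : k := (-1) ^+ i.
have ss i : s i * s i = 1.
  by rewrite -expr2 sqrr_sign.
pose chi (p q : triple d) : k := (q == p)%:R.
pose lam p : k := chi (tri xy yz) p * (s x * s y * s z)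
  + chi (tri xy yt) p * - (s x * s y * s t)
  + chi (tri xz zt) p * (s x * s z * s t)
  + chi (tri yz zt) p * - (s y * s z * s t).
have chiE (f : triple d -> k) p a : \sum_q (chi p q * a) * f q = a * f p.
  rewrite (bigD1 p) //= big1 ?addr0 => [|q /negPf qp]; last first.
    by rewrite /chi qp !mul0r.
  by rewrite /chi eqxx mul1r.
exists (\row_c lam (col_triple c)).
  apply/eqP => /rowP/(_ (ci (tri xy yz))); rewrite !mxE cKi /lam /chi eqxx.
  rewrite -!val_eqE /= !xpair_eqE -!val_eqE /=.
  rewrite (ltn_eqF zt) (ltn_eqF yz) (ltn_eqF xy) !andbF /= !mul0r mul1r.
  rewrite !addr0 => /eqP.
  by rewrite !mulf_eq0 !signr_eq0.
apply/rowP => r; rewrite [RHS]mxE mxE; set m := (val (row_index r).1).1.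
set n := (val (row_index r).1).2.
pose f p : k := (eqn_lhs [ffun=> 1 : k^o] (unit_lam k p) m n : k)
  * coord e (row_index r).2 (v p).
transitivity (\sum_p lam p * f p).
  rewrite [RHS](reindex (@col_triple d)) /=; last by exists ci => c _.
  by apply: eq_bigr => c _; rewrite mxE [_^T _ _]mxE coef_mxE.
under eq_bigr => p _ do rewrite /lam !mulrDl.
rewrite !big_split /= !chiE /f v1 v2 v3.
have E p := eqn_lhs_unit_lam k p m n.
rewrite (E (tri xy yz)) (E (tri xy yt)) (E (tri xz zt)) (E (tri yz zt)) /=.
rewrite -/(s x) -/(s y) -/(s z) -/(s t).
(* Each edge of the tetrahedron lies in two faces, whose contributions cancel. *)
ring: (ss x) (ss y) (ss z) (ss t).
Qed.

End Determinant.

Theorem theorem3p8 (k : fieldType) (char0 : [pchar k] =i pred0)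
    (d : nat) (hd : (2 <= d)%N)
    (V : vectType k) (e : d.-tuple V) (he : basis_of fullv e)
    (T : tensorPower V (triple d)) :
  [/\ linear (detS3 e T),
      exists w : T, detS3 e T w != 0
    & forall v : {ffun triple d -> V},
        (exists (x y z t : 'I_(3 * d))
           (xy : (x < y)%N) (yz : (y < z)%N) (zt : (z < t)%N),
           [/\ v (tri xy yz) = v (tri xy (ltn_trans yz zt)),
               v (tri xy (ltn_trans yz zt)) = v (tri (ltn_trans xy yz) zt)
             & v (tri (ltn_trans xy yz) zt) = v (tri yz zt)]) ->
        detS3 e T (pure T v) = 0].
Proof.
split=> [a x y||v [x [y [z [t [xy [yz [zt [v1 v2 v3]]]]]]]]].
- exact: linearP.
- by eexists (pure T _); rewrite detS3_pure; apply: det_coef_class_neq0.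
- by rewrite detS3_pure; apply: det_coef_tetrahedron v1 v2 v3.
Qed.
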